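(* Let $T$ be an operator-valued unilateral weighted shift (bounded) on $\mathcal H=\oplus_{n\in\mathbb N}H_n$ with operator weights $\{A_n:n\in\mathbb N\}$. Suppose that $\dim H_0\ge 1$ and that for each $n\in\mathbb N$ there exists an orthonormal basis $B_n$ of $H_n$ with the following property: for each $x\in B_n$ there exists a subset $W_x$ of $B_{n+1}$ such that (a) $B_{n+1}=\bigsqcup_{x\in B_n}W_x$ (disjoint union), (b) for each $x\in B_n$, $\langle A_nx,y\rangle\neq 0$ for all $y\in W_x$ and $A_nx=\sum_{y\in W_x}\langle A_nx,y\rangle y$. Then $T$ is unitarily equivalent to a direct sum of $\dim H_0$ many weighted shifts on rooted directed trees.
   Context: $\mathbb N$ is the set of non-negative integers. $\{H_n\}_{n\in\mathbb N}$ are complex separable Hilbert spaces, $\mathcal H=\oplus_{n\in\mathbb N}H_n$ is their orthogonal direct sum, and $A_n:H_n\to H_{n+1}$ are bounded linear operators with $\sup_n\|A_n\|<\infty$. The operator-valued unilateral weighted shift $T$ with operator weights $\{A_n\}$ is the bounded operator $T(\oplus_{n}x_n)=\oplus_{n}A_{n-1}x_{n-1}$, with $0$-th entry $0$. $\dim$ denotes Hilbert space dimension. A rooted directed tree $(V,\mathcal E)$ is a directed graph that has no circuits, is connected (as an undirected graph), and has a vertex $\mathsf{root}$ with no incoming edge such that every other vertex $v$ has exactly one parent $\mathsf{par}(v)$, i.e. exactly one $u$ with $(u,v)\in\mathcal E$. The weighted shift on it with weights $\{\lambda_v\in\mathbb C:v\in V\setminus\{\mathsf{root}\}\}$ is the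 operator in $\ell^2(V)$ given by $(S_\lambda f)(v)=\lambda_vf(\mathsf{par}(v))$ for $v\ne\mathsf{root}$ and $(S_\lambda f)(\mathsf{root})=0$. *)

(* Defs.v *)
From HB Require Import structures.
From mathcomp Require Import all_boot all_order all_algebra.
From mathcomp Require Import finmap complex.
From mathcomp Require Import all_classical all_reals all_analysis.
From mathcomp Require summability.
From mathcomp Require Import ring lra.
Set Implicit Arguments.
Unset Strict Implicit.
Unset Printing Implicit Defensive.
Import Order.TTheory GRing.Theory Num.Theory.
Import numFieldNormedType.Exports.
Local Open Scope classical_set_scope.
Local Open Scope complex_scope.
Local Open Scope ring_scope.

#[global] Existing Instance summability.totally_filter.

(* {dot H for conj}: positive definite Hermitian form, linear in the first and
   conjugate-linear in the second argument. *)
HB.mixin Record CompleteNormedModule_isHilbert (R : realType) H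
    & CompleteNormedModule R[i] H := {
  inner : {dot H for (@Num.conj R[i])} ;
  inner_normE : forall x : H, inner x x = `|x| ^+ 2
}.

#[short(type="hilbertType")]
HB.structure Definition Hilbert (R : realType) :=
  {H of CompleteNormedModule_isHilbert R H & CompleteNormedModule R[i] H}.

Notation "''[' x , y ]" := (inner x y) : ring_scope.

(* Unconditional summation: norm convergence of the net of finite partial sums. *)
Definition has_sum (R : realType) (I : choiceType) (V : normedModType R[i])
    (D : set I) (f : I -> V) (s : V) : Prop :=
  \sum_(i <- J | i \in D) f i @[J --> summability.totally] --> s.

Lemma polarization_identity (K : numFieldType) (a b c d e i : K) :
  i * i = -1 -> a = 4%:R^-1 * (c + d + (a + b) - (c + d - (a + b))
    + i * (c + e + (- i * a + i * b)) - i * (c + e - (- i * a + i * b))).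
Proof.
move=> i2.
transitivity (4%:R^-1 * (2%:R * (a + b) - 2%:R * (i * i) * (a - b))).
  by rewrite i2; field.
by congr (_ * _); ring.
Qed.

Section dot_norm.
Variables (R : realType) (U : lmodType R[i]).
Variable (f : {dot U for (@Num.conj R[i])}).

Lemma dot_CauchySchwarz (u v : U) : `|f u v| ^+ 2 <= f u u * f v v.
Proof.
have [->|v0] := eqVneq v 0.
  have f0 w : f w 0 = 0 by exact: linear0r.
  by rewrite !f0 normr0 expr0n mulr0.
have fv : 0 < f v v by rewrite dnorm_gt0.
have fvr : (f v v)^* = f v v by apply/CrealP/ger0_real/ltW.
pose a := f u v / f v v.
have := dnorm_ge0 f (u - a *: v).
have -> : f (u - a *: v) (u - a *: v) = f u u - `|f u v| ^+ 2 / f v v.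
  rewrite linearBl !linearBr /= !linearZl_LR !linearZr_LR /=.
  have -> : f v u = (f u v)^* by rewrite hermC /= expr0 mul1r.
  rewrite normCK /a rmorphM /= fmorphV /= fvr.
  by rewrite /GRing.scale /=; field; rewrite gt_eqF.
by rewrite subr_ge0 ler_pdivrMr.
Qed.

Definition dot_norm (u : U) : R[i] := sqrtC (f u u).

Lemma dot_norm_ge0 u : 0 <= dot_norm u.
Proof. exact: sqrt_dnorm_ge0. Qed.

Lemma dot_normK u : dot_norm u ^+ 2 = f u u.
Proof. exact: sqrtCK. Qed.

Lemma ler_dot_normD u v : dot_norm (u + v) <= dot_norm u + dot_norm v.
Proof.
rewrite -(@ler_pXn2r _ 2) ?nnegrE ?addr_ge0 ?dot_norm_ge0//.
have -> : (dot_norm u + dot_norm v) ^+ 2 =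
    f u u + f v v + 2%:R * (dot_norm u * dot_norm v).
  by rewrite -!dot_normK; ring.
rewrite dot_normK dnormD lerD2l.
have -> : f u v + (f u v)^* = 2%:R * 'Re (f u v).
  by rewrite ReE mulrC divfK// pnatr_eq0.
rewrite ler_pM2l ?ltr0n//.
apply: (@le_trans _ _ `|f u v|).
  exact: (leif_Re_Creal (f u v)).1.
rewrite -(@ler_pXn2r _ 2) ?nnegrE ?mulr_ge0 ?dot_norm_ge0//.
by rewrite exprMn !dot_normK dot_CauchySchwarz.
Qed.

Lemma dot_normZ (a : R[i]) u : dot_norm (a *: u) = `|a| * dot_norm u.
Proof.
apply/eqP; rewrite -(@eqrXn2 _ 2) ?mulr_ge0 ?dot_norm_ge0//.
by rewrite exprMn !dot_normK dnormZ.
Qed.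

Lemma dot_norm_eq0 u : dot_norm u = 0 -> u = 0.
Proof. by move/eqP; rewrite sqrt_dnorm_eq0 => /eqP. Qed.

Lemma dot_polarization u v : f u v =
  4%:R^-1 * (f (u + v) (u + v) - f (u - v) (u - v)
    + 'i%R * f (u + 'i%R *: v) (u + 'i%R *: v)
    - 'i%R * f (u - 'i%R *: v) (u - 'i%R *: v)).
Proof.
have E : f u ('i%R *: v) = - 'i%R * f u v by rewrite linearZr_LR /= conjCi.
have Ec : (f u ('i%R *: v))^* = 'i%R * (f u v)^*.
  by rewrite E rmorphM /= rmorphN /= conjCi opprK.
have i2 : ('i%R : R[i]) * 'i%R = -1 by rewrite -expr2 sqrCi.
by rewrite !dnormB !dnormD Ec E; exact: polarization_identity.
Qed.

End dot_norm.

Section sums.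
Variables (R : realType) (I : choiceType).
Local Notation C := R[i].

Lemma bounded_sum (f : I -> C) (M : C) :
  (forall i, 0 <= f i) -> (forall J : {fset I}, \sum_(i <- J) f i <= M) ->
  exists2 s : C, (forall J : {fset I}, \sum_(i <- J) f i <= s) /\ s <= M
    & \sum_(i <- J) f i @[J --> summability.totally] --> (s : C^o).
Proof.
move=> f0 fM.
pose S (J : {fset I}) := \sum_(i <- J) f i.
have S0 J : 0 <= S J by exact: sumr_ge0.
have SR J : S J = (complex.Re (S J))%:C by rewrite RRe_real// ger0_real.
have SS (J K : {fset I}) : (J `<=` K)%fset -> S J <= S K.
  move=> JK; rewrite /S (big_fsetID _ (mem J) K)/=.
  have -> : [fset x | x in K & x \in J]%fset = J.
    apply/fsetP => i; rewrite !inE/=; case: (boolP (i \in J)) => [iJ|];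
      rewrite ?andbF// andbT.
    by rewrite (fsubsetP JK).
  by rewrite lerDl sumr_ge0.
have M0 : 0 <= M by apply: le_trans (fM fset0); exact: S0.
have MR : M = (complex.Re M)%:C by rewrite RRe_real// ger0_real.
pose A := [set complex.Re (S J) | J in [set: {fset I}]].
have AM : ubound A (complex.Re M).
  by move=> _ [J _ <-]; have := fM J; rewrite -/(S J) lecE => /andP[].
have A0 : A !=set0 by exists (complex.Re (S fset0)); exists fset0.
have supA : has_sup A by split => //; exists (complex.Re M).
exists (sup A)%:C.
  split; first by move=> J; rewrite -/(S J) SR lecR; apply: sup_upper_bound => //; exists J.
  by rewrite MR lecR; apply: ge_sup.
apply/(@cvgrPdist_le _ C^o) => e e0.
have eR : e = (complex.Re e)%:C by rewrite RRe_real// ger0_real// ltW.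
have e'0 : 0 < complex.Re e by rewrite -ltcR -eR.
have [_ [J _ <-] Je] := sup_adherent e'0 supA.
exists J => // K /= JK; rewrite -/(S K) SR -rmorphB /= normc_def /=.
rewrite expr0n addr0 sqrtr_sqr eR lecR ger0_norm; last first.
  by rewrite subr_ge0; apply: sup_upper_bound => //; exists K.
have := SS _ _ JK; rewrite SR [leRHS]SR lecR => h.
by rewrite lerBlDr -lerBlDl; apply: le_trans h; apply: ltW.
Qed.

End sums.

Section hsum_def.
Variables (R : realType) (I : choiceType) (H : I -> hilbertType R).
Local Notation C := R[i].

(* hsum H is the orthogonal direct sum of the H i: the families x with
   sum_i |x i|^2 < +oo. *)
Definition square_summable (x : forall i, H i) : Prop :=
  (\esum_(i in [set: I]) (complex.Re `|x i| ^+ 2)%:E < +oo)%E.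

Record hsum := HSum {
  hcoord :> forall i, H i ;
  hsumP : square_summable hcoord }.

Lemma hsum_ext (x y : hsum) : (forall i, x i = y i) -> x = y.
Proof.
case: x y => [x xP] [y yP] /= xy.
have e : x = y by apply: functional_extensionality_dep.
by case: _ / e yP => yP; congr HSum; exact: Prop_irrelevance.
Qed.

Lemma square_summableP (x : forall i, H i) : square_summable x <->
  exists M : C, forall J : {fset I}, \sum_(i <- J) `|x i| ^+ 2 <= M.
Proof.
have E (J : {fset I}) : \sum_(i <- J) `|x i| ^+ 2 =
    (\sum_(i <- J) (complex.Re `|x i|) ^+ 2)%:C.
  rewrite rmorph_sum /=; apply: eq_bigr => i _.
  by rewrite rmorphXn /= RRe_real ?normr_real.
split => [xoo|[M xM]].
- exists (fine (\esum_(i in [set: I]) (complex.Re `|x i| ^+ 2)%:E))%:C => J.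
  have esum0 : (0 <= \esum_(i in [set: I]) (complex.Re `|x i| ^+ 2)%:E)%E.
    by apply: esum_ge0 => i _; rewrite lee_fin sqr_ge0.
  rewrite E lecR -lee_fin fineK ?ge0_fin_numE//.
  apply: ereal_sup_ubound; exists [set` J] => //.
  by rewrite fsbig_finite//= set_fsetK -sumEFin.
- apply: le_lt_trans (ltry (complex.Re M)).
  apply: ge_ereal_sup => _ [X [finX _] <-].
  rewrite fsbig_finite//= sumEFin lee_fin.
  by have := xM (fset_set X); rewrite E lecE /= => /andP[].
Qed.

Lemma square_summable0 : square_summable (fun i => 0 : H i).
Proof.
apply/square_summableP; exists 0 => J.
by rewrite big1// => i _; rewrite normr0 expr0n.
Qed.

Lemma square_summableZ (a : C) (x : forall i, H i) :
  square_summable x -> square_summable (fun i => a *: x i).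
Proof.
move=> /square_summableP[M xM]; apply/square_summableP.
exists (`|a| ^+ 2 * M) => J.
under eq_bigr do rewrite normrZ exprMn.
by rewrite -mulr_sumr ler_wpM2l// exprn_ge0.
Qed.

Lemma parallelogram (i : I) (u v : H i) :
  `|u + v| ^+ 2 + `|u - v| ^+ 2 = 2%:R * `|u| ^+ 2 + 2%:R * `|v| ^+ 2.
Proof. by rewrite -!inner_normE dnormB dnormD; ring. Qed.

Lemma square_summableD (x y : forall i, H i) :
  square_summable x -> square_summable y ->
  square_summable (fun i => x i + y i).
Proof.
move=> /square_summableP[M xM] /square_summableP[N yN].
apply/square_summableP; exists (2%:R * M + 2%:R * N) => J.
apply: (@le_trans _ _
   (\sum_(i <- J) (2%:R * `|x i| ^+ 2 + 2%:R * `|y i| ^+ 2))).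
  by apply: ler_sum => i _; rewrite -parallelogram lerDl exprn_ge0.
by rewrite big_split /= -!mulr_sumr lerD// ler_wpM2l.
Qed.

Lemma square_summableN (x : forall i, H i) :
  square_summable x -> square_summable (fun i => - x i).
Proof.
move=> /square_summableP[M xM]; apply/square_summableP; exists M => J.
by under eq_bigr do rewrite normrN.
Qed.

HB.instance Definition _ := gen_eqMixin hsum.
HB.instance Definition _ := gen_choiceMixin hsum.

Definition hsum_zero := HSum square_summable0.
Definition hsum_opp (x : hsum) := HSum (square_summableN (hsumP x)).
Definition hsum_add (x y : hsum) :=
  HSum (square_summableD (hsumP x) (hsumP y)).
Definition hsum_scale (a : C) (x : hsum) :=
  HSum (square_summableZ a (hsumP x)).

Fact hsum_addA : associative hsum_add.
Proof. by move=> x y z; apply: hsum_ext => i /=; rewrite addrA. Qed.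
Fact hsum_addC : commutative hsum_add.
Proof. by move=> x y; apply: hsum_ext => i /=; rewrite addrC. Qed.
Fact hsum_add0 : left_id hsum_zero hsum_add.
Proof. by move=> x; apply: hsum_ext => i /=; rewrite add0r. Qed.
Fact hsum_addN : left_inverse hsum_zero hsum_opp hsum_add.
Proof. by move=> x; apply: hsum_ext => i /=; rewrite addNr. Qed.

HB.instance Definition _ :=
  GRing.isZmodule.Build hsum hsum_addA hsum_addC hsum_add0 hsum_addN.

Fact hsum_scaleA a b (x : hsum) :
  hsum_scale a (hsum_scale b x) = hsum_scale (a * b) x.
Proof. by apply: hsum_ext => i /=; rewrite scalerA. Qed.
Fact hsum_scale1 : left_id 1 hsum_scale.
Proof. by move=> x; apply: hsum_ext => i /=; rewrite scale1r. Qed.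
Fact hsum_scaleDr : right_distributive hsum_scale +%R.
Proof. by move=> a x y; apply: hsum_ext => i /=; rewrite scalerDr. Qed.
Fact hsum_scaleDl (x : hsum) : {morph hsum_scale^~ x : a b / a + b}.
Proof. by move=> a b; apply: hsum_ext => i /=; rewrite scalerDl. Qed.

HB.instance Definition _ := GRing.Zmodule_isLmodule.Build C hsum
  hsum_scaleA hsum_scale1 hsum_scaleDr hsum_scaleDl.

Lemma hsumDE (x y : hsum) i : (x + y) i = x i + y i. Proof. by []. Qed.
Lemma hsumNE (x : hsum) i : (- x) i = - x i. Proof. by []. Qed.
Lemma hsumZE a (x : hsum) i : (a *: x) i = a *: x i. Proof. by []. Qed.

Lemma hsum_sqr_cvg (x : hsum) : exists2 s : C,
  (forall J : {fset I}, \sum_(i <- J) `|x i| ^+ 2 <= s) /\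
  (forall M, (forall J : {fset I}, \sum_(i <- J) `|x i| ^+ 2 <= M) -> s <= M)
  & \sum_(i <- J) '[x i, x i] @[J --> summability.totally] --> (s : C^o).
Proof.
have [M xM] := (square_summableP x).1 (hsumP x).
have x0 i : 0 <= `|x i| ^+ 2 by rewrite exprn_ge0.
have [s [sub _] xs] := bounded_sum x0 xM.
exists s; last by under eq_fun do under eq_bigr do rewrite inner_normE.
split => // N xN; have [t [_ tN] xt] := bounded_sum x0 xN.
suff -> : s = t by [].
exact: (@cvg_unique _ (@norm_hausdorff _ C^o) _ _ _ _ xs xt).
Qed.

Definition hsum_inner (x y : hsum) : C :=
  lim (\sum_(i <- J) '[x i, y i] @[J --> summability.totally] : set_system C^o).

End hsum_def.

Section real_limits.
Variable K : numFieldType.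

Lemma cvg_real_le (T : Type) (F : set_system T) (f : T -> K^o) (a b : K) :
  ProperFilter F -> a \is Num.real -> f @ F --> (a : K^o) ->
  (forall x, f x \is Num.real) -> (\forall x \near F, f x <= b) -> a <= b.
Proof.
move=> FF ar fa fr fb.
have br : b \is Num.real.
  by have [x xb] := filter_ex fb; rewrite -(ler_real xb).
rewrite real_leNgt//; apply/negP => ba.
have h : (a + b) / 2%:R < a by rewrite ltr_pdivrMr ?ltr0n// mulr_natr mulr2n ltrD2l.
have := @real_cvgr_ge K T F FF f a ar fa _ h; move=> /(filterI fb) /filter_ex.
move=> [x [xb /(_ (fr x)) /le_trans/(_ xb)]].
rewrite ler_pdivrMr ?ltr0n// mulr_natr mulr2n lerD2r => ab.
by move: (lt_le_trans ba ab); rewrite ltxx.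
Qed.

Lemma cvg_sqnorm_sum (T : Type) (F : set_system T) (I : Type)
    (V : I -> normedModType K) (f : forall i, T -> V i) (a : forall i, V i) (J : seq I) :
  Filter F -> (forall i, f i @ F --> a i) ->
  \sum_(i <- J) `|f i y| ^+ 2 @[y --> F] --> (\sum_(i <- J) `|a i| ^+ 2 : K^o).
Proof.
move=> FF fa; elim: J => [|i J IH].
  by rewrite big_nil; under eq_fun do rewrite big_nil; exact: cvg_cst.
rewrite big_cons; under eq_fun do rewrite big_cons.
apply: (@cvgD _ K^o) => //.
have h : `|f i y| @[y --> F] --> (`|a i| : K) by apply: cvg_norm; exact: fa.
exact: (cvgM h h).
Qed.

Lemma cvg_lincomb (T : Type) (F : set_system T) (f g h : T -> K^o) (c a b : K) :
  Filter F -> f @ F --> (a : K^o) -> g @ F --> (b : K^o) ->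
  (forall x, h x = c * f x + g x) -> h @ F --> (c * a + b : K^o).
Proof.
by move=> FF fa gb /funext ->; apply: cvgD => //; apply: cvgMl_tmp.
Qed.

Lemma cvg_polarization (T : Type) (F : set_system T) (f1 f2 f3 f4 h : T -> K^o)
    (c i s1 s2 s3 s4 : K) : Filter F ->
  f1 @ F --> (s1 : K^o) -> f2 @ F --> (s2 : K^o) ->
  f3 @ F --> (s3 : K^o) -> f4 @ F --> (s4 : K^o) ->
  (forall x, h x = c * (f1 x - f2 x + i * f3 x - i * f4 x)) ->
  h @ F --> (c * (s1 - s2 + i * s3 - i * s4) : K^o).
Proof.
move=> FF h1 h2 h3 h4 /funext ->; apply: cvgMl_tmp; apply: cvgB; last exact: cvgMl_tmp.
by apply: cvgD; [exact: cvgB|exact: cvgMl_tmp].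
Qed.

End real_limits.

Section hsum_hilbert.
Variables (R : realType) (I : choiceType) (H : I -> hilbertType R).
Local Notation C := R[i].
Local Notation hsum := (hsum H).
Implicit Types x y z : hsum.

Local Notation csum f := (fun J : {fset I} => \sum_(i <- J) f i : C^o).
Local Notation csum_to f l := (csum f @ summability.totally --> (l : C^o)).

Lemma hsum_inner_cvg x y : csum_to (fun i => '[x i, y i]) (hsum_inner x y).
Proof.
suff : exists l : C, csum_to (fun i => '[x i, y i]) l.
  move=> [l xl]; rewrite /hsum_inner.
  by rewrite (@cvg_lim C^o (@norm_hausdorff _ C^o) _ _ _ _ _ xl).
have [s1 _ h1] := hsum_sqr_cvg (x + y).
have [s2 _ h2] := hsum_sqr_cvg (x - y).
have [s3 _ h3] := hsum_sqr_cvg (x + 'i%R *: y).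
have [s4 _ h4] := hsum_sqr_cvg (x - 'i%R *: y).
exists (4%:R^-1 * (s1 - s2 + 'i%R * s3 - 'i%R * s4)).
apply: (@cvg_polarization C _ _ _ _ _ _ (csum (fun i => '[x i, y i]))
  4%:R^-1 'i%R s1 s2 s3 s4 _ h1 h2 h3 h4) => J.
rewrite !mulr_sumr -sumrB -big_split -sumrB mulr_sumr.
by apply: eq_bigr => i _; rewrite [LHS](dot_polarization inner (x i) (y i)).
Qed.

Let csum_unique f (a b : C) : csum_to f a -> csum_to f b -> a = b.
Proof. exact: (@cvg_unique _ (@norm_hausdorff _ C^o)). Qed.

Fact hsum_inner_linearl y : GRing.linear_for *%R (fun x : hsum => hsum_inner x y).
Proof.
move=> a u v /=; apply: csum_unique; first exact: hsum_inner_cvg.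
apply: (@cvg_lincomb C _ _ _ _ (csum (fun i => '[(a *: u + v) i, y i]))
  a _ _ _ (@hsum_inner_cvg u y) (@hsum_inner_cvg v y)) => J.
rewrite mulr_sumr -big_split /=.
by apply: eq_bigr => i _; rewrite [LHS](linearPl inner (y i) a (u i) (v i)).
Qed.

Fact hsum_inner_conj x y : hsum_inner x y = (hsum_inner y x)^*.
Proof.
apply: csum_unique; first exact: hsum_inner_cvg.
have h := @hsum_inner_cvg y x.
apply/(@cvgrPdist_le _ C^o) => e e0.
move/(@cvgrPdist_le _ C^o) : h => /(_ e e0); apply: filterS => J.
have -> : \sum_(i <- J) '[x i, y i] = (\sum_(i <- J) '[y i, x i])^*.
  rewrite rmorph_sum; apply: eq_bigr => i _ /=.
  by rewrite hermC /= expr0 mul1r.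
by rewrite -rmorphB /= norm_conjC.
Qed.

Fact hsum_inner_linearr x :
  GRing.linear_for (@Num.conj C \; *%R) (hsum_inner x : hsum -> C).
Proof.
move=> a u v; rewrite hsum_inner_conj hsum_inner_linearl rmorphD rmorphM /=.
by rewrite -!hsum_inner_conj.
Qed.

HB.instance Definition _ := bilinear_isBilinear.Build C hsum hsum C
  (GRing.Scale.Law.clone _ _ ( *%R ) _)
  (GRing.Scale.Law.clone _ _ (@Num.conj C \; *%R ) _)
  (@hsum_inner R I H) (hsum_inner_linearl, hsum_inner_linearr).

Fact hsum_inner_hermitian x y :
  hsum_inner x y = (-1) ^+ false * (hsum_inner y x)^*.
Proof. by rewrite expr0 mul1r hsum_inner_conj. Qed.

HB.instance Definition _ := isHermitianSesquilinear.Build C hsum false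
  (@Num.conj C) (@hsum_inner R I H) hsum_inner_hermitian.

Lemma hsum_inner_sup x :
  (forall J : {fset I}, \sum_(i <- J) `|x i| ^+ 2 <= hsum_inner x x) /\
  (forall M, (forall J : {fset I}, \sum_(i <- J) `|x i| ^+ 2 <= M) ->
     hsum_inner x x <= M).
Proof.
have [s sP xs] := hsum_sqr_cvg x.
by rewrite (csum_unique (@hsum_inner_cvg x x) xs).
Qed.

Lemma hsum_coord_le_inner x i : `|x i| ^+ 2 <= hsum_inner x x.
Proof. by have := (hsum_inner_sup x).1 [fset i]%fset; rewrite big_seq_fset1. Qed.

Fact hsum_inner_gt0 x : x != 0 -> 0 < hsum_inner x x.
Proof.
move=> /eqP x0; have /existsNP[i /eqP xi] : ~ forall i, x i = 0.
  by move=> h; apply: x0; apply: hsum_ext.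
by apply: lt_le_trans (hsum_coord_le_inner x i); rewrite exprn_gt0// normr_gt0.
Qed.

HB.instance Definition _ := isDotProduct.Build C hsum
  (@hsum_inner R I H) hsum_inner_gt0.

Definition hsum_dot : {dot hsum for (@Num.conj C)} := @hsum_inner R I H.

HB.instance Definition _ := Lmodule_isNormed.Build C hsum
  (ler_dot_normD hsum_dot) (dot_normZ hsum_dot) (@dot_norm_eq0 _ _ hsum_dot).

Fact hsum_inner_normE x : hsum_dot x x = `|x| ^+ 2.
Proof. by rewrite [RHS](dot_normK hsum_dot). Qed.

Lemma hsum_coord_le x i : `|x i| <= `|x|.
Proof.
rewrite -(@ler_pXn2r _ 2) ?nnegrE// -hsum_inner_normE.
exact: hsum_coord_le_inner.
Qed.

Lemma hsum_norm_le x (M : C) : 0 <= M ->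
  (forall J : {fset I}, \sum_(i <- J) `|x i| ^+ 2 <= M ^+ 2) -> `|x| <= M.
Proof.
move=> M0 h; rewrite -(@ler_pXn2r _ 2) ?nnegrE// -hsum_inner_normE.
exact: (hsum_inner_sup x).2.
Qed.

Fact hsum_complete (F : set_system hsum) :
  ProperFilter F -> cauchy F -> cvg F.
Proof.
move=> FF /cauchyP cF.
have cvgi i : cvg ((fun y : hsum => y i) @ F).
  apply: cauchy_cvg; apply: cauchy_exP => e e0; have [x Fx] := cF e e0.
  exists (x i); suff : F [set z : hsum | ball (x i) e (z i)] by [].
  apply: filterS Fx => y; rewrite -!ball_normE /= => xy.
  by apply: le_lt_trans xy; exact: (hsum_coord_le (x - y) i).
pose l i := lim ((fun y : hsum => y i) @ F).
have key x (e : C) : F (ball x e) ->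
    forall J : {fset I}, \sum_(i <- J) `|x i - l i| ^+ 2 <= e ^+ 2.
  move=> Fx J.
  apply: (@cvg_real_le _ _ F (fun y => \sum_(i <- J) `|x i - y i| ^+ 2)).
  - by apply: ger0_real; apply: sumr_ge0 => i _; exact: exprn_ge0.
  - apply: cvg_sqnorm_sum => i; apply: cvgB; [exact: cvg_cst|exact: cvgi].
  - by move=> y; apply: ger0_real; apply: sumr_ge0 => i _; exact: exprn_ge0.
  apply: filterS Fx => y; rewrite -ball_normE /= => xy.
  apply: (le_trans ((hsum_inner_sup (x - y)).1 J)).
  have e0 : 0 <= e by apply: (le_trans _ (ltW xy)); exact: normr_ge0.
  rewrite [leLHS]hsum_inner_normE ler_pXn2r ?nnegrE//; exact: ltW.
have [x1 Fx1] := cF 1 ltr01.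
have lS : square_summable l.
  have -> : l = (fun i => x1 i + - (x1 i - l i)).
    by apply: functional_extensionality_dep => i; rewrite opprB addrC subrK.
  apply: square_summableD; first exact: hsumP.
  apply: square_summableN; apply/square_summableP; exists (1 ^+ 2).
  exact: key.
apply/cvg_ex; exists (HSum lS); apply/cvgrPdist_le => e e0.
have e20 : 0 < e / 2%:R by rewrite divr_gt0// ltr0n.
have [x Fx] := cF _ e20; apply: filterS (Fx) => y; rewrite -ball_normE /= => xy.
rewrite (splitr e) -(subrK x (HSum lS)) -addrA.
apply: (le_trans (ler_normD _ _)); apply: lerD; last exact: ltW.
by rewrite distrC; apply: hsum_norm_le; [exact: ltW|exact: key].
Qed.

HB.instance Definition _ := Uniform_isComplete.Build hsum hsum_complete.
HB.instance Definition _ := CompleteNormedModule_isHilbert.Build R hsum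
  hsum_inner_normE.

End hsum_hilbert.

(* C as a Hilbert space over itself. The alias of R[i]^o avoids a clash with the
   library's completeness instance for R^o with R : realType. *)
Definition scalarH (R : realType) : Type := R[i]^o.

Section scalar_hilbert.
Variable R : realType.
Local Notation C := R[i].

HB.instance Definition _ := NormedModule.copy (scalarH R) C^o.

Definition scalar_inner (x y : scalarH R) : C := (x : C) * (y : C)^*.

Fact scalar_inner_linearl y :
  GRing.linear_for *%R (fun x : scalarH R => scalar_inner x y).
Proof. by move=> a u v; rewrite /scalar_inner mulrDl mulrA. Qed.

Fact scalar_inner_linearr x :
  GRing.linear_for (@Num.conj C \; *%R) (scalar_inner x : scalarH R -> C).
Proof.
by move=> a u v; rewrite /scalar_inner rmorphD rmorphM /= mulrDr mulrCA.
Qed.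

HB.instance Definition _ :=
  bilinear_isBilinear.Build C (scalarH R) (scalarH R) C
  (GRing.Scale.Law.clone _ _ ( *%R ) _)
  (GRing.Scale.Law.clone _ _ (@Num.conj C \; *%R ) _)
  scalar_inner (scalar_inner_linearl, scalar_inner_linearr).

Fact scalar_inner_hermitian x y :
  scalar_inner x y = (-1) ^+ false * (scalar_inner y x)^*.
Proof. by rewrite expr0 mul1r /scalar_inner rmorphM /= conjCK mulrC. Qed.

HB.instance Definition _ := isHermitianSesquilinear.Build C (scalarH R) false
  (@Num.conj C) scalar_inner scalar_inner_hermitian.

Fact scalar_inner_normE x : scalar_inner x x = `|x| ^+ 2.
Proof. by rewrite [RHS]normCK. Qed.

Fact scalar_inner_gt0 x : x != 0 -> 0 < scalar_inner x x.
Proof. by move=> x0; rewrite scalar_inner_normE exprn_gt0// normr_gt0. Qed.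

HB.instance Definition _ := isDotProduct.Build C (scalarH R)
  scalar_inner scalar_inner_gt0.

Lemma complex_norm_le (z : C) :
  `|z| <= (`|complex.Re z| + `|complex.Im z|)%:C.
Proof.
rewrite [z in `|z|]complexE rmorphD /=; apply: (le_trans (ler_normD _ _)).
rewrite normrM; have -> : `|'i%C : C| = 1.
  by rewrite normc_def /= expr0n /= add0r expr1n sqrtr1.
by rewrite mul1r !normc_def /= expr0n !addr0 !sqrtr_sqr.
Qed.

Fact scalar_complete (F : set_system (scalarH R)) :
  ProperFilter F -> cauchy F -> cvg F.
Proof.
move=> FF /cauchyP cF.
have cvgp (p : C -> R) : (forall u v, p u - p v = p (u - v)) ->
    (forall z, `|p z|%:C <= `|z|) -> cvg ((p : scalarH R -> R) @ F).
  move=> pB pn; apply: cauchy_cvg; apply: cauchy_exP => e e0.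
  have e0' : 0 < e%:C :> C by rewrite ltcR.
  have [x Fx] := cF _ e0'; exists (p x).
  suff : F [set z : scalarH R | ball (p x) e (p z)] by [].
  apply: filterS Fx => y; rewrite -!ball_normE /= => xy.
  by rewrite pB -ltcR; apply: le_lt_trans (pn _) _.
have cR : cvg ((@complex.Re R : scalarH R -> R) @ F).
  apply: cvgp => [[a b] [c d]//|z]; rewrite normc_def lecR.
  by rewrite -sqrtr_sqr ler_wsqrtr// lerDl sqr_ge0.
have cI : cvg ((@complex.Im R : scalarH R -> R) @ F).
  apply: cvgp => [[a b] [c d]//|z]; rewrite normc_def lecR.
  by rewrite -sqrtr_sqr ler_wsqrtr// lerDr sqr_ge0.
pose a := lim ((@complex.Re R : scalarH R -> R) @ F).
pose b := lim ((@complex.Im R : scalarH R -> R) @ F).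
apply/cvg_ex; exists (a +i* b : scalarH R).
apply/cvgrPdist_le => e e0.
have eR : e = (complex.Re e)%:C by rewrite RRe_real// ger0_real// ltW.
have e'0 : 0 < complex.Re e / 2%:R by rewrite divr_gt0// -ltcR -eR.
move/cvgrPdist_le : cR => /(_ _ e'0) hR.
move/cvgrPdist_le : cI => /(_ _ e'0) hI.
apply: filterS2 hR hI => z hR hI.
apply: (le_trans (complex_norm_le _)).
rewrite eR lecR [leRHS]splitr.
by case: z hR hI => z1 z2 /= hR hI; apply: lerD.
Qed.

HB.instance Definition _ := Uniform_isComplete.Build (scalarH R) scalar_complete.
HB.instance Definition _ := CompleteNormedModule_isHilbert.Build R (scalarH R)
  scalar_inner_normE.

End scalar_hilbert.

Section hilbert_notions.
Variable R : realType.
Implicit Types H K : hilbertType R.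

Definition separable_space H : Prop := exists2 D : set H, countable D & dense D.

Definition lin_span H (B : set H) : set H :=
  [set x | exists (s : seq H) (c : H -> R[i]),
    {subset s <= B} /\ x = \sum_(b <- s) c b *: b].

Definition orthonormal_basis H (B : set H) : Prop :=
  (forall x y, B x -> B y -> '[x, y] = (x == y)%:R) /\ dense (lin_span B).

(* The Hilbert space dimension of H is the cardinality of I. *)
Definition has_hdim H (I : Type) : Prop :=
  exists2 B : set H, orthonormal_basis B & (B #= [set: I])%card.

Definition hdim_ge1 H : Prop :=
  exists2 B : set H, orthonormal_basis B & (`I_1 #<= B)%card.

(* Norms in a normed module over R[i] are R[i]-valued, hence the real part. *)
Definition opnorm H K (T : {linear H -> K}) : \bar R :=
  ereal_sup [set (complex.Re `|T x|)%:E | x in [set x | `|x| <= 1]].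

Definition bounded_operator H K (T : {linear H -> K}) : Prop :=
  (opnorm T < +oo)%E.

Definition unitary H K (U : {linear H -> K}) : Prop :=
  (forall x y, '[U x, U y] = '[x, y]) /\ (forall y, exists x, U x = y).

Definition unitarily_equivalent H K (T : {linear H -> H}) (S : {linear K -> K}) :
    Prop :=
  exists2 U : {linear H -> K}, unitary U & forall x, U (T x) = S (U x).

Definition is_opshift (H : nat -> hilbertType R)
    (A : forall n, {linear H n -> H n.+1}) (T : {linear hsum H -> hsum H}) : Prop :=
  forall x : hsum H, T x 0%N = 0 /\ forall n, T x n.+1 = A n (x n).

Definition is_direct_sum (I : choiceType) (H : I -> hilbertType R)
    (S : forall i, {linear H i -> H i}) (D : {linear hsum H -> hsum H}) : Prop :=
  forall (x : hsum H) i, D x i = S i (x i).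

End hilbert_notions.

Record rooted_tree := RootedTree {
  vertex :> choiceType ;
  edge : rel vertex ;
  tree_root : vertex ;
  (* no directed circuit of length >= 1; in particular no loop *)
  no_circuit : forall c : seq vertex, c != [::] -> ~~ ucycleb edge c ;
  tree_connected : forall u v, exists p : seq vertex,
    path (fun x y => edge x y || edge y x) u p /\ last u p = v ;
  root_no_parent : forall u, ~~ edge u tree_root ;
  unique_parent : forall v, v != tree_root -> exists! u, edge u v }.

(* The unique u with edge u v; the value at the root is a dummy. *)
Definition par (V : rooted_tree) (v : V) : V :=
  xget (tree_root V) [set u | edge u v].

Definition ell2 (R : realType) (V : rooted_tree) : hilbertType R :=
  hsum (fun _ : V => scalarH R).

(* lam (tree_root V) is never used: only weights at non-root vertices matter. As S is
   total on ell2 R V, this asserts that the shift maps ell2 R V into itself. *)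
Definition is_tree_shift (R : realType) (V : rooted_tree) (lam : V -> R[i])
    (S : {linear ell2 R V -> ell2 R V}) : Prop :=
  forall f : ell2 R V, S f (tree_root V) = 0 /\
    forall v, v != tree_root V -> S f v = lam v * f (par v).

(* Main.v *)
From HB Require Import structures.
Require Import Defs.
From mathcomp Require Import all_boot all_order all_algebra.
From mathcomp Require Import finmap complex.
From mathcomp Require Import ring.
From mathcomp Require Import all_classical all_reals all_analysis.
Set Implicit Arguments.
Unset Strict Implicit.
Unset Printing Implicit Defensive.
Import Order.TTheory GRing.Theory Num.Theory.
Import numFieldNormedType.Exports.
Local Open Scope classical_set_scope.
Local Open Scope complex_scope.
Local Open Scope ring_scope.

(** The hypotheses make the union of the bases B n into a forest: draw an edge from
    x in B n to each y in W n x. As these sets partition B n.+1, every basis vector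
    of level n.+1 has one parent, so the connected components are rooted directed
    trees, one for each element k of B 0, and there are dim H 0 of them. The vertices
    of the tree of k are the basis vectors in the sets descendants W k n, each tagged
    by its level n.

    Expanding a vector in the bases gives a map U from the direct sum of the H n to
    the direct sum over k of the spaces ell2 of the trees. It is unitary
    (tree_unitary): Parseval and Riesz-Fischer identify H n with the square-summable
    families on B n, and a sum over all basis vectors may be taken level by level or
    tree by tree (esum_levels_trees).

    As A n x is a sum over W n x, the vectors A n x with x in B n have disjoint
    supports in B n.+1. So for y in W n p the functional sending x to the y-th
    coefficient of A n x vanishes on every element of B n but p, and

      '[A n x, y] = '[x, p] * '[A n p, y]

    for every x (inner_child). In coordinates T is therefore the weighted shift
    whose weight at y is '[A n p, y], with p the parent of y, and it vanishes at the
    roots. Conjugating T by U gives the direct sum of the tree shifts. *)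

(** * Sums over arbitrary index sets *)

Definition set_elt (T : Type) (D : set T) (x : T) (Dx : D x) : D :=
  exist (fun x => x \in D) x (mem_set Dx).

Lemma big_fset_split (V : nmodType) (T : choiceType) (P : pred T) (f : T -> V)
    (J K : {fset T}) : (J `<=` K)%fset ->
  \sum_(i <- K | P i) f i =
    \sum_(i <- J | P i) f i + \sum_(i <- (K `\` J)%fset | P i) f i.
Proof.
move=> JK; rewrite !(big_mkcond P) (big_fsetID _ (mem J) K)/=.
congr (_ + _); apply: congr_big => //; congr enum_fset; apply/fsetP => b.
  by rewrite !inE/= andbC; apply/andb_idr/(fsubsetP JK).
by rewrite !inE/= andbC.
Qed.

Section real_esum.
Variables (R : realType) (T : choiceType) (D : set T) (f : T -> R).

Lemma fset_sum_le_esum (J : {fset T}) : (forall b, 0 <= f b) ->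
  ((\sum_(b <- J | b \in D) f b)%:E <= \esum_(b in D) (f b)%:E)%E.
Proof.
move=> f0; rewrite esum_mkcond; apply: ereal_sup_ubound.
exists [set` J] => //.
by rewrite fsbig_finite//= set_fsetK -sumEFin [RHS]big_mkcond.
Qed.

Lemma ge_esum_fset (M : \bar R) :
  (forall J : {fset T}, (\sum_(b <- J | b \in D) f b)%:E <= M)%E ->
  (\esum_(b in D) (f b)%:E <= M)%E.
Proof.
move=> fM; apply: ge_ereal_sup => _ [X [finX XB] <-].
rewrite fsbig_finite//= sumEFin; have := fM (fset_set X).
rewrite big_seq_cond [in X in _ -> X]big_seq; congr (_%:E <= _)%E.
apply: eq_bigl => b; apply/andb_idr; rewrite in_fset_set// => /set_mem/XB Bb.
exact: mem_set.
Qed.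

End real_esum.

Section esum_regrouping.
Local Open Scope ereal_scope.
Variables (R : realType) (T : choiceType) (a : T -> \bar R).
Hypothesis a_ge0 : forall x, 0 <= a x.

Lemma esum_partition (I : choiceType) (K : set I) (J : I -> set T) :
  trivIset K J ->
  \esum_(x in \bigcup_(k in K) J k) a x = \esum_(k in K) \esum_(x in J k) a x.
Proof.
move=> tJ; rewrite esum_esum//; apply: reindex_esum; split.
- by move=> [k x] [Kk Jx]; exists k.
- move=> [k x] [l y]; rewrite !inE/= => -[Kk kx] [Kl ly] xy; rewrite -xy in ly *.
  by rewrite (tJ k l Kk Kl)//; exists x.
- by move=> x [k Kk kx]; exists (k, x).
Qed.

Lemma esum_set_type (D : set T) :
  \esum_(v in [set: D]) a (val v) = \esum_(v in D) a v.
Proof.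
apply/esym/reindex_esum; split.
- by move=> v _; apply: set_mem; exact: valP.
- by move=> u v _ _ /val_inj.
- by move=> x Dx; exists (set_elt Dx).
Qed.

Lemma esum_term_lty (g : T -> \bar R) : (forall x, 0 <= g x) ->
  \esum_(x in [set: T]) g x < +oo -> forall x, g x < +oo.
Proof.
move=> g0 goo x.
have gs : summable [set: T] g.
  by rewrite /summable; under eq_esum do rewrite gee0_abs//.
by have := @summable_pinfty _ _ _ _ gs x Logic.I; rewrite gee0_abs.
Qed.

End esum_regrouping.

(** * Square norms and inner products *)

Section squared_norm.
Variable R : realType.
Local Notation C := R[i].

Definition sqnorm (V : normedModType C) (x : V) : R := complex.Re `|x| ^+ 2.

Lemma sqnormE (V : normedModType C) (x : V) : (sqnorm x)%:C = `|x| ^+ 2.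
Proof. by rewrite /sqnorm rmorphXn /= RRe_real ?normr_real. Qed.

Lemma sqnorm_ge0 (V : normedModType C) (x : V) : 0 <= sqnorm x.
Proof. exact: sqr_ge0. Qed.

Lemma sqnorm0 (V : normedModType C) : sqnorm (0 : V) = 0.
Proof. by rewrite /sqnorm normr0 expr0n. Qed.

Lemma ler_sqnorm (V W : normedModType C) (x : V) (y : W) :
  (sqnorm x <= sqnorm y) = (`|x| <= `|y|).
Proof. by rewrite -lecR !sqnormE ler_pXn2r ?nnegrE. Qed.

Lemma sqnorm_inj (V W : normedModType C) (x : V) (y : W) :
  sqnorm x = sqnorm y -> `|x| = `|y|.
Proof. by move=> xy; apply/eqP; rewrite eq_le -!ler_sqnorm xy lexx. Qed.

(** Extended-real sums of nonnegative terms can be regrouped and reindexed without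
    convergence conditions, so this is the form in which norms of direct sums are
    compared below. *)
Lemma hsum_sqnormE (I : choiceType) (H : I -> hilbertType R) (x : hsum H) :
  (sqnorm x)%:E = (\esum_(i in [set: I]) (sqnorm (x i))%:E)%E.
Proof.
have [lex gex] := hsum_inner_sup x.
have xE : hsum_inner x x = (sqnorm x)%:C by rewrite sqnormE -hsum_inner_normE.
rewrite xE in lex gex.
have sumE (J : {fset I}) : \sum_(i <- J) `|x i| ^+ 2 =
    (\sum_(i <- J | i \in [set: I]) sqnorm (x i))%:C.
  under [in RHS]eq_bigl do rewrite in_setT.
  by rewrite rmorph_sum /=; apply: eq_bigr => i _; rewrite sqnormE.
have ge0 i : 0 <= sqnorm (x i) by exact: sqnorm_ge0.
apply/eqP; rewrite eq_le; apply/andP; split; last first.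
  by apply: ge_esum_fset => J; have := lex J; rewrite sumE lecR lee_fin.
have oo : (\esum_(i in [set: I]) (sqnorm (x i))%:E < +oo)%E := hsumP x.
have oof : (\esum_(i in [set: I]) (sqnorm (x i))%:E)%E \is a fin_num.
  by rewrite ge0_fin_numE// esum_ge0// => i _; rewrite lee_fin.
rewrite -(fineK oof) lee_fin -lecR; apply: gex => J.
by rewrite sumE lecR -lee_fin fineK// fset_sum_le_esum.
Qed.

End squared_norm.

Section inner_product.
Variables (R : realType) (H : hilbertType R).
Local Notation C := R[i].
Implicit Types x y : H.

Lemma innerBl x y z : '[x - y, z] = '[x, z] - '[y, z].
Proof. exact: linearBl. Qed.

Lemma innerZl (a : C) x y : '[a *: x, y] = a * '[x, y].
Proof. exact: linearZl_LR. Qed.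

Lemma inner_suml (I : Type) (r : seq I) (P : pred I) (f : I -> H) y :
  '[\sum_(i <- r | P i) f i, y] = \sum_(i <- r | P i) '[f i, y].
Proof. exact: linear_sumlz. Qed.

Lemma inner_conj x y : '[x, y] = '[y, x]^*.
Proof. by rewrite hermC /= expr0 mul1r. Qed.

Lemma cauchy_schwarz x y : `|'[x, y]| <= `|x| * `|y|.
Proof.
rewrite -(@ler_pXn2r _ 2) ?nnegrE ?mulr_ge0// exprMn -!inner_normE.
exact: dot_CauchySchwarz.
Qed.

Lemma sqnormB x y :
  `|x - y| ^+ 2 = `|x| ^+ 2 + `|y| ^+ 2 - ('[x, y] + '[y, x]).
Proof. by rewrite -!inner_normE dnormB (inner_conj y x). Qed.

End inner_product.

(** Polarization. *)
Lemma isometry_inner (R : realType) (H K : hilbertType R) (U : {linear H -> K}) :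
  (forall x, `|U x| = `|x|) -> forall x y, '[U x, U y] = '[x, y].
Proof.
move=> nU x y.
have sq z : '[U z, U z] = '[z, z] by rewrite !inner_normE nU.
rewrite [LHS](dot_polarization inner) [RHS](dot_polarization inner).
by rewrite -!sq !linearD !linearN !linearZ.
Qed.

(** * Orthonormal bases *)

Section orthonormal_basis_theory.
Variables (R : realType) (H : hilbertType R) (B : set H).
Hypothesis onbB : orthonormal_basis B.
Local Notation C := R[i].
Implicit Types (x y b : H) (J : {fset H}) (c : H -> C).

Local Notation comb c J := (\sum_(b <- J | b \in B) c b *: b).
Local Notation Fourier x J := (comb (fun b => '[x, b]) J).

Lemma inner_comb c J b : B b -> '[comb c J, b] = if b \in J then c b else 0.
Proof.
move=> Bb; have [onB _] := onbB; rewrite inner_suml.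
under eq_bigr => b' /set_mem Bb' do rewrite innerZl onB// mulr_natr mulrb.
rewrite -big_mkcondr/=; case: ifPn => bJ; last first.
  by rewrite big_seq_cond big1// => b' /andP[b'J /andP[_ /eqP bb']];
     rewrite bb' (negPf bJ) in b'J.
rewrite big_mkcond (big_fsetD1 b bJ)/= mem_set// eqxx big_seq big1 ?addr0//.
by move=> b'; rewrite !inE => /andP[/negPf ->]; rewrite andbF.
Qed.

Lemma sqnorm_comb c J : `|comb c J| ^+ 2 = \sum_(b <- J | b \in B) `|c b| ^+ 2.
Proof.
rewrite -inner_normE inner_suml big_seq_cond [RHS]big_seq_cond.
apply: eq_bigr => b /andP[bJ /set_mem Bb].
by rewrite innerZl inner_conj inner_comb// bJ normCK.
Qed.

Lemma inner_Fourier x J : '[Fourier x J, x] = \sum_(b <- J | b \in B) `|'[x, b]| ^+ 2.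
Proof.
rewrite inner_suml; apply: eq_bigr => b _.
by rewrite innerZl (inner_conj b x) normCK.
Qed.

(** Pythagoras: a finite Fourier sum is an orthogonal projection. *)
Lemma sqnorm_Fourier x J :
  `|x - Fourier x J| ^+ 2 = `|x| ^+ 2 - \sum_(b <- J | b \in B) `|'[x, b]| ^+ 2.
Proof.
rewrite sqnormB sqnorm_comb inner_Fourier (inner_conj x (Fourier _ _)).
rewrite inner_Fourier rmorph_sum /=.
under [X in _ - (X + _)]eq_bigr do rewrite rmorphXn /= conj_normC.
by rewrite opprD addrA addrK.
Qed.

Lemma Bessel x J : \sum_(b <- J | b \in B) `|'[x, b]| ^+ 2 <= `|x| ^+ 2.
Proof. by rewrite -subr_ge0 -sqnorm_Fourier exprn_ge0. Qed.

Lemma Fourier_span y : lin_span B y -> exists J, Fourier y J = y.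
Proof.
move=> [s [c [sB ->]]]; exists [fset b | b in s]%fset.
under eq_bigr do rewrite inner_suml scaler_suml.
rewrite exchange_big /= big_seq [RHS]big_seq; apply: eq_bigr => b bs.
have bB : B b by exact/set_mem/sB.
have [onB _] := onbB.
have bJ : b \in [fset b | b in s]%fset by rewrite !inE.
rewrite big_mkcond (big_fsetD1 b bJ)/= mem_set// innerZl onB// eqxx mulr1.
rewrite big_seq big1 ?addr0// => b'; rewrite !inE/= => /andP[bb' _].
case: ifP => // /set_mem Bb'.
by rewrite innerZl onB// eq_sym (negPf bb') mulr0 scale0r.
Qed.

(** The finite Fourier sums come arbitrarily close to the vector: the projection
    fixes a nearby element of the span and contracts the difference. *)
Lemma Fourier_dense x (e : C) : 0 < e -> exists J, `|x - Fourier x J| < e.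
Proof.
move=> e0; have [_ dB] := onbB.
have [y [/= xy /Fourier_span[J yJ]]] : ball x e `&` lin_span B !=set0.
  by apply: dB; [exists x; exact: ballxx|exact: ball_open].
exists J; apply: (@le_lt_trans _ _ `|x - y|); last by rewrite -ball_normE in xy.
have FB : Fourier (x - y) J = Fourier x J - y.
  rewrite -[in RHS]yJ -sumrB; apply: eq_bigr => b _.
  by rewrite innerBl scalerBl.
have -> : x - Fourier x J = (x - y) - Fourier (x - y) J.
  by rewrite FB opprB addrA subrK.
rewrite -(@ler_pXn2r _ 2) ?nnegrE// sqnorm_Fourier gerBl.
by apply: sumr_ge0 => b _; rewrite exprn_ge0.
Qed.

(** Bessel bounds the finite sums from above; approximating by Fourier sums shows
    that the bound is their supremum. *)
Theorem Parseval x :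
  (\esum_(b in B) (sqnorm ('[x, b] : scalarH R))%:E = (sqnorm x)%:E)%E.
Proof.
have sumE J : \sum_(b <- J | b \in B) `|'[x, b]| ^+ 2 =
    (\sum_(b <- J | b \in B) sqnorm ('[x, b] : scalarH R))%:C.
  by rewrite rmorph_sum /=; apply: eq_bigr => i _; rewrite sqnormE.
apply/eqP; rewrite eq_le; apply/andP; split.
  apply: ge_esum_fset => J.
  by have := Bessel x J; rewrite sumE -sqnormE lecR lee_fin.
apply/lee_addgt0Pr => e e0.
(* Norms enter squared, so an error e asks for an approximation within sqrt e. *)
have e0' : 0 < (Num.sqrt e)%:C :> C by rewrite ltcR sqrtr_gt0.
have [J Je] := Fourier_dense x e0'.
have : `|x - Fourier x J| ^+ 2 <= e%:C.
  rewrite -(sqr_sqrtr (ltW e0)) rmorphXn /= ler_pXn2r ?nnegrE//; first exact: ltW.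
  by rewrite lecR sqrtr_ge0.
rewrite sqnorm_Fourier sumE -sqnormE lerBlDl -rmorphD lecR -lee_fin EFinD.
move=> /le_trans; apply; rewrite leeD2r//; apply: fset_sum_le_esum => b.
exact: sqnorm_ge0.
Qed.

(** The finite partial sums of the series with coefficients c form a Cauchy net,
    since the squared norm of a difference of two nested ones is a tail of a
    convergent sum of squares. Completeness gives the vector. *)
Theorem Riesz_Fischer c :
  (\esum_(b in B) (sqnorm (c b : scalarH R))%:E < +oo)%E ->
  exists x, forall b, B b -> '[x, b] = c b.
Proof.
set s := (\esum_(b in B) _)%E => soo.
pose S J := \sum_(b <- J | b \in B) sqnorm (c b : scalarH R).
have c0 b : 0 <= sqnorm (c b : scalarH R) by exact: sqnorm_ge0.
have combE J : `|comb c J| ^+ 2 = (S J)%:C.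
  by rewrite sqnorm_comb rmorph_sum /=; apply: eq_bigr => i _; rewrite sqnormE.
have sfin : s \is a fin_num.
  by rewrite ge0_fin_numE// esum_ge0// => i _; rewrite lee_fin.
have Ss J : S J <= fine s by rewrite -lee_fin fineK// fset_sum_le_esum.
have SU J K : (J `<=` K)%fset -> S K = S J + S (K `\` J)%fset.
  by move=> JK; rewrite /S (big_fset_split _ _ JK).
have combU J K : (J `<=` K)%fset -> comb c K - comb c J = comb c (K `\` J)%fset.
  by move=> JK; rewrite (big_fset_split _ _ JK) addrAC subrr add0r.
pose F := comb c J @[J --> summability.totally].
have cF : cvg F.
  apply: cauchy_cvg; apply: cauchy_exP => e e0.
  have eR : e = (complex.Re e)%:C by rewrite RRe_real// ger0_real// ltW.
  have e'0 : 0 < complex.Re e ^+ 2 by rewrite exprn_gt0// -ltcR -eR.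
  have [J sJ] : exists J, fine s - complex.Re e ^+ 2 < S J.
    apply/not_existsP => h.
    suff : fine s <= fine s - complex.Re e ^+ 2 by rewrite lerBrDr gerDl leNgt e'0.
    rewrite -lee_fin fineK//; apply: ge_esum_fset => J; rewrite lee_fin.
    by rewrite leNgt; apply/negP/h.
  exists (comb c J); exists J => // K /= JK.
  rewrite -ball_normE /= distrC combU// -(@ltr_pXn2r _ 2) ?nnegrE//; last exact: ltW.
  rewrite combE [in ltRHS]eR -rmorphXn ltcR.
  move: (Ss K) sJ; rewrite (SU J)// => h1 h2.
  by rewrite -(ltrD2l (S J)) (le_lt_trans h1)// -ltrBlDr.
(* Beyond an index set containing b, the b-th coefficient of the partial sums is c b. *)
exists (lim F) => b Bb; apply/eqP; rewrite -subr_eq0 -normr_le0.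
apply/ler_addgt0Pr => e e0; rewrite add0r.
move/cvgrPdist_le : cF => /(_ _ e0) [J _ /(_ (J `|` [fset b])%fset)] /=.
move=> /(_ (fsubsetUl _ _)) xe.
have bJ : b \in (J `|` [fset b])%fset by rewrite !inE eqxx orbT.
have <- : '[comb c (J `|` [fset b])%fset, b] = c b by rewrite inner_comb// bJ.
rewrite -innerBl; apply: (le_trans (cauchy_schwarz _ _)).
suff -> : `|b| = 1 by rewrite mulr1.
have [onB _] := onbB; apply/eqP; rewrite -(@eqrXn2 _ 2)// -inner_normE onB//.
by rewrite eqxx expr1n.
Qed.

End orthonormal_basis_theory.

(** * Bounded operators and functionals *)

Lemma dep_choice (I : Type) (T : I -> Type) (P : forall i, T i -> Prop) :
  (forall i, exists x, P i x) -> exists f : forall i, T i, forall i, P i (f i).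
Proof. by move=> h; exists (fun i => projT1 (cid (h i))) => i; case: cid. Qed.

Lemma linear_bundle (K : pzRingType) (U V : lmodType K) (f : U -> V) :
  linear f -> exists g : {linear U -> V}, forall x, g x = f x.
Proof.
move=> lf.
pose g : {linear U -> V} := HB.pack f (GRing.isLinear.Build K U V *:%R f lf).
by exists g.
Qed.

Section bounded_operators.
Variable R : realType.
Local Notation C := R[i].

Lemma le_opnorm (H K : hilbertType R) (T : {linear H -> K}) (M : R) :
  (opnorm T <= M%:E)%E -> forall x, `|T x| <= M%:C * `|x|.
Proof.
move=> TM x; have [->|x0] := eqVneq x 0; first by rewrite linear0 !normr0 mulr0.
have x0' : 0 < `|x| by rewrite normr_gt0.
rewrite -ler_pdivrMr// mulrC.
have -> : `|x|^-1 * `|T x| = `|T (`|x|^-1 *: x)|.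
  by rewrite linearZ /= normrZ ger0_norm// invr_ge0.
rewrite -(@RRe_real _ `|T _|) ?normr_real// lecR -lee_fin.
apply: le_trans TM; apply: ereal_sup_ubound; exists (`|x|^-1 *: x) => //=.
by rewrite normrZ ger0_norm ?invr_ge0// mulVf ?normr_eq0.
Qed.

Lemma bounded_operatorP (H K : hilbertType R) (T : {linear H -> K}) (M : R) :
  0 <= M -> (forall x, `|T x| <= M%:C * `|x|) -> bounded_operator T.
Proof.
move=> M0 TM; apply: le_lt_trans (ltry M).
apply: ge_ereal_sup => _ [x /= x1 <-]; rewrite lee_fin -lecR.
rewrite RRe_real ?normr_real// (le_trans (TM x))//.
by rewrite -[leRHS]mulr1 ler_wpM2l// lecR.
Qed.

Lemma opnorm_ge0 (H K : hilbertType R) (T : {linear H -> K}) : (0 <= opnorm T)%E.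
Proof.
apply: ereal_sup_ubound; exists 0; first by rewrite /= normr0.
by rewrite linear0 normr0.
Qed.

Lemma opnorm_sup (H : nat -> hilbertType R) (A : forall n, {linear H n -> H n.+1}) :
  (ereal_sup [set opnorm (A n) | n in [set: nat]] < +oo)%E ->
  exists2 M : R, 0 <= M & forall n x, `|A n x| <= M%:C * `|x|.
Proof.
set s := ereal_sup _ => soo.
have As n : (opnorm (A n) <= s)%E by apply: ereal_sup_ubound; exists n.
have s0 : (0 <= s)%E := le_trans (opnorm_ge0 _) (As 0%N).
exists (fine s); first exact: fine_ge0.
by move=> n; apply: le_opnorm; rewrite fineK ?ge0_fin_numE.
Qed.

(** Apply the bound on A to each summand; the shift only moves the summands. *)
Lemma opshift_le (H : nat -> hilbertType R) (A : forall n, {linear H n -> H n.+1})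
    (T : {linear hsum H -> hsum H}) (M : R) : is_opshift A T -> 0 <= M ->
  (forall n x, `|A n x| <= M%:C * `|x|) -> forall x, `|T x| <= M%:C * `|x|.
Proof.
move=> TA M0 AM x.
have Msq (V W : normedModType C) (u : V) (v : W) :
    (`|u| <= M%:C * `|v|) = (sqnorm u <= M ^+ 2 * sqnorm v).
  have vE : (M ^+ 2 * sqnorm v)%:C = (M%:C * `|v|) ^+ 2.
    by rewrite exprMn -sqnormE -rmorphXn -rmorphM.
  by rewrite -[in RHS]lecR vE sqnormE ler_pXn2r ?nnegrE// mulr_ge0// lecR.
rewrite Msq -lee_fin hsum_sqnormE (esumID [set 0%N])//; last first.
  by move=> n _; rewrite lee_fin sqnorm_ge0.
rewrite setTI esum_set1 ?lee_fin ?sqnorm_ge0// (TA x).1.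
have -> : [set: nat] `&` ~` [set 0%N] = [set n.+1 | n in [set: nat]].
  by apply/seteqP; split=> [[[_ /(_ erefl)[]]|n _]|_ [n _ <-]]; [exists n|split].
rewrite esum_image; last by move=> m n _ _ [].
rewrite sqnorm0 add0e.
apply: ge_esum_fset => J; rewrite lee_fin.
have Jx : \sum_(n <- J | n \in [set: nat]) sqnorm (x n) <= sqnorm x.
  by rewrite -lee_fin hsum_sqnormE fset_sum_le_esum// => n; exact: sqnorm_ge0.
apply: le_trans (ler_wpM2l (sqr_ge0 M) Jx); rewrite mulr_sumr.
by apply: ler_sum => n _; rewrite (TA x).2 -Msq; exact: AM.
Qed.

Lemma functional_kernel_closed (H : hilbertType R) (f : {linear H -> scalarH R}) (L : R) x :
  0 <= L -> (forall z, `|f z| <= L%:C * `|z|) ->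
  (forall e : C, 0 < e -> exists2 z, `|x - z| <= e & f z = 0) -> f x = 0.
Proof.
move=> L0 fL fx; apply/eqP; rewrite -normr_le0; apply/ler_addgt0Pr => e e0.
have L1 : 0 < (L + 1)%:C :> C by rewrite ltcR ltr_wpDl.
have [z xz fz] := fx _ (divr_gt0 e0 L1).
rewrite add0r -[f x]subr0 -fz -linearB (le_trans (fL _))//.
rewrite -[leRHS](divfK (lt0r_neq0 L1)) mulrC.
by apply: ler_pM => //; rewrite ?lecR// lerDl.
Qed.

(** The Fourier sums of a vector approximate it, and the functional kills them. *)
Lemma functional_onb_eq0 (H : hilbertType R) (B : set H)
    (f : {linear H -> scalarH R}) (L : R) :
  orthonormal_basis B -> 0 <= L -> (forall z, `|f z| <= L%:C * `|z|) ->
  (forall b, B b -> f b = 0) -> forall x, f x = 0.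
Proof.
move=> onbB L0 fL fB x; apply: (functional_kernel_closed L0 fL) => e e0.
have [J xJ] := Fourier_dense onbB x e0.
exists (\sum_(b <- J | b \in B) '[x, b] *: b); first exact: ltW.
by rewrite linear_sum big1// => b /set_mem Bb; rewrite linearZ/= fB// scaler0.
Qed.

Lemma has_sum_orthogonal (H : hilbertType R) (D : set H) (f : H -> H) (s y : H) :
  has_sum D f s -> (forall i, D i -> '[f i, y] = 0) -> '[s, y] = 0.
Proof.
move=> fs fy.
have lin : linear (fun z => '[z, y] : scalarH R).
  by move=> a u v; rewrite (linearPl inner).
have [g gE] := linear_bundle lin.
rewrite -[LHS]gE; apply: (@functional_kernel_closed _ _ (complex.Re `|y|)).
- by rewrite -lecR RRe_real ?normr_real//; exact: normr_ge0.
- by move=> z; rewrite gE RRe_real ?normr_real// mulrC cauchy_schwarz.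
- move=> e e0; move/cvgrPdist_le : fs => /(_ e e0) [J _ /(_ J (fsubset_refl _)) sJ].
  exists (\sum_(i <- J | i \in D) f i) => //.
  by rewrite gE inner_suml big1// => i /set_mem; exact: fy.
Qed.

End bounded_operators.

(** * Vectors of a direct sum *)

Section hsum_embedding.
Variables (R : realType) (I : choiceType) (H : I -> hilbertType R).

(** The isometric embedding of one summand, extending its vectors by zero. *)
Lemma hsum_inj (k : I) : exists2 j : {linear H k -> hsum H},
  (forall f, `|j f| = `|f|) & forall f, j f k = f.
Proof.
have sumE f : (\esum_(i in [set: I]) (sqnorm (dfwith (fun i => 0 : H i) k f i))%:E =
    (sqnorm f)%:E)%E.
  rewrite (esumID [set k])//; last by move=> i _; rewrite lee_fin sqnorm_ge0.
  rewrite setTI esum_set1 ?lee_fin ?sqnorm_ge0// dfwithin esum1 ?adde0//.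
  move=> i [_ /eqP ik]; rewrite dfwithout 1?eq_sym//.
  by rewrite sqnorm0.
have ss f : square_summable (dfwith (fun i => 0 : H i) k f).
  by rewrite /square_summable [ltLHS]sumE ltry.
have lin : linear (fun f => HSum (ss f)).
  move=> a u v; apply: hsum_ext => i /=.
  have [ki|ik] := eqVneq k i; first by case: _ / ki; rewrite !dfwithin.
  by rewrite !dfwithout// scaler0 addr0.
have [j jE] := linear_bundle lin; exists j => f; rewrite jE; last exact: dfwithin.
by apply: sqnorm_inj; apply: EFin_inj; rewrite hsum_sqnormE sumE.
Qed.

End hsum_embedding.

Section hsum_nested.
Variables (R : realType) (I : choiceType) (V : I -> choiceType).
Variable (H : forall i, V i -> hilbertType R).
Arguments H : clear implicits.
Local Notation HH := (hsum (fun i => hsum (H i))).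

Lemma hsum_nested_sqnormE (x : HH) :
  (sqnorm x)%:E = (\esum_(i in [set: I]) \esum_(v in [set: V i]) (sqnorm (x i v))%:E)%E.
Proof.
by rewrite hsum_sqnormE; apply: eq_esum => i _; rewrite hsum_sqnormE.
Qed.

Lemma hsum_nested_exists (f : forall i (v : V i), H i v) :
  (\esum_(i in [set: I]) \esum_(v in [set: V i]) (sqnorm (f i v))%:E < +oo)%E ->
  exists x : HH, forall i v, x i v = f i v.
Proof.
move=> foo; pose g i := (\esum_(v in [set: V i]) (sqnorm (f i v))%:E)%E.
have g0 i : (0 <= g i)%E.
  by apply: esum_ge0 => v _; rewrite lee_fin sqnorm_ge0.
have fi : forall i, square_summable (f i) := esum_term_lty g0 foo.
have fI : square_summable (fun i => HSum (fi i) : hsum (H i)).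
  rewrite /square_summable.
  by under eq_esum do rewrite -/(sqnorm _) hsum_sqnormE.
by exists (HSum fI).
Qed.

End hsum_nested.

(** * The trees of descendants *)

Section undirected_paths.
Variables (T : eqType) (e : rel T).
Hypothesis e_sym : symmetric e.

Definition joined (u v : T) := exists p, path e u p /\ last u p = v.

Lemma joined_trans u v w : joined u v -> joined v w -> joined u w.
Proof.
move=> [p [up <-]] [q [uq <-]]; exists (p ++ q).
by rewrite cat_path up uq last_cat.
Qed.

Lemma joined_sym u v : joined u v -> joined v u.
Proof.
move=> [p [up <-]]; exists (rev (belast u p)); split.
  by rewrite rev_path; under eq_path do rewrite e_sym.
by case: p {up} => //= a p; rewrite rev_cons last_rcons.
Qed.

End undirected_paths.

Section forest.
Variables (E : nat -> choiceType) (B : forall n, set (E n)).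
Variable (W : forall n, E n -> set (E n.+1)).
Arguments B : clear implicits.
Arguments W : clear implicits.
Hypothesis disjW : forall n, trivIset (B n) (W n).
Hypothesis unionW : forall n, B n.+1 = \bigcup_(x in B n) W n x.

Definition node := {n & E n}.

Fixpoint descendants (k : E 0%N) (n : nat) : set (E n) :=
  match n with
  | 0 => [set k]
  | m.+1 => \bigcup_(x in @descendants k m) W m x
  end.
Arguments descendants : clear implicits.

Lemma descendants_sub k n : B 0%N k -> descendants k n `<=` B n.
Proof.
move=> Bk; elim: n => [y -> //|n IH y [x kx xy]].
by rewrite unionW; exists x => //; exact: IH.
Qed.

Lemma descendants_cover n (y : E n) :
  B n y -> exists2 k, B 0%N k & descendants k n y.
Proof.
elim: n y => [y By|n IH y]; first by exists y.
by rewrite unionW => -[x /IH[k Bk kx] xy]; exists k => //; exists x.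
Qed.

Lemma parent_inj n (x x' : E n) y : B n x -> B n x' -> W n x y -> W n x' y -> x = x'.
Proof. by move=> Bx Bx' xy x'y; apply: (disjW Bx Bx'); exists y. Qed.

Lemma descendants_inj k k' n (y : E n) : B 0%N k -> B 0%N k' ->
  descendants k n y -> descendants k' n y -> k = k'.
Proof.
move=> Bk Bk'; elim: n y => [y -> //|n IH y [x kx xy] [x' kx' x'y]].
have xx' : x = x'.
  by apply: parent_inj xy x'y; [exact: descendants_sub kx|exact: descendants_sub kx'].
by apply: IH kx _; rewrite xx'.
Qed.

Definition nodes : set node := [set v : node | B (tag v) (tagged v)].

Definition tree_nodes (k : E 0%N) : set node :=
  [set v : node | descendants k (tag v) (tagged v)].

Lemma nodes_bigcup : nodes = \bigcup_(k in B 0%N) tree_nodes k.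
Proof.
apply/seteqP; split=> [[n y] /descendants_cover[k Bk ky]|[n y] [k Bk ky]].
  by exists k.
exact: descendants_sub ky.
Qed.

(** Both sides sum over all nodes: each node lies on one level and in one tree. *)
Lemma esum_levels_trees (R : realType) (F : node -> \bar R) :
  (forall v, 0 <= F v)%E ->
  (\esum_(n in [set: nat]) \esum_(y in B n) F (existT _ n y) =
   \esum_(k in [set: B 0%N]) \esum_(v in [set: tree_nodes (val k)]) F (val v))%E.
Proof.
move=> F0.
transitivity (\esum_(v in nodes) F v)%E.
  have -> : nodes = \bigcup_(n in [set: nat]) [set existT _ n y | y in B n].
    apply/seteqP; split=> [[n y] Bv|_ [n _ [y By <-]]//].
    by exists n => //; exists y.
  rewrite esum_partition//; last first.
    by move=> n m _ _ [_ [[y _ <-] [z _ /(congr1 tag)]]].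
  apply: eq_esum => n _; rewrite esum_image// => x y _ _ /eqP.
  by rewrite eq_Tagged => /eqP.
have -> : nodes = \bigcup_(k in [set: B 0%N]) tree_nodes (val k).
  by rewrite nodes_bigcup bigcup_set_type.
rewrite esum_partition//; first by apply: eq_esum => k _; rewrite esum_set_type.
move=> k k' _ _ [v [kv k'v]]; apply: val_inj.
by apply: descendants_inj kv k'v; apply: set_mem; exact: valP.
Qed.

Section tree_of_root.
Variable k : B 0%N.

Definition arc (u v : node) : Prop :=
  exists2 y, W _ (tagged u) y & v = existT _ (tag u).+1 y.

Let V : choiceType := tree_nodes (val k).

Definition tree_edge : rel V := fun u v => `[< arc (val u) (val v) >].

Definition root_node : V :=
  @set_elt node (tree_nodes (val k)) (existT _ 0%N (val k)) erefl.

Lemma edge_level u v : tree_edge u v -> tag (val v) = (tag (val u)).+1.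
Proof. by move=> /asboolP[y _ ->]. Qed.

Lemma path_level u p : path tree_edge u p ->
  tag (val (last u p)) = (tag (val u) + size p)%N.
Proof.
elim: p u => [|v p IH] u /=; first by rewrite addn0.
by move=> /andP[/edge_level uv /IH ->]; rewrite uv addSnnS.
Qed.

(** Edges raise the level by one, so no path returns to its starting point. *)
Lemma edge_no_circuit (c : seq V) : c != [::] -> ~~ ucycleb tree_edge c.
Proof.
case: c => // u p _; apply/negP => /andP[/= /path_level].
rewrite last_rcons size_rcons => /eqP.
by rewrite -[X in X == _]addn0 eqn_add2l.
Qed.

Lemma root_no_edge u : ~~ tree_edge u root_node.
Proof. by apply/negP => /edge_level. Qed.

(** Only the root lies at level 0, and every deeper node was reached from a node
    of the same tree. *)
Lemma nodeP (v : V) : v = root_node \/ exists u, tree_edge u v.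
Proof.
case: v => -[[|n] y] vV; have /= := set_mem vV.
  by move=> yk; left; apply: val_inj; rewrite /= -yk.
move=> [x kx xy]; right.
by exists (@set_elt node (tree_nodes (val k)) (existT _ n x) kx); apply/asboolP; exists y.
Qed.

(** The sets W n x being disjoint, a node is reached from one parent only. *)
Lemma edge_unique_parent v : v != root_node -> exists! u, tree_edge u v.
Proof.
have [->|[u uv]] := nodeP v; first by rewrite eqxx.
move=> _; exists u; split => // u' /asboolP u'v; move/asboolP: uv.
case: u u' u'v => [[n x] xV] [[n' x'] xV'] /= [y' x'y' ->] [y xy yy'].
have nn' : n = n' by case: yy'.
move: (set_mem xV) (set_mem xV') => kx kx'.
case: _ / nn' x' xV' kx' y' x'y' yy' => x' xV' kx' y' x'y' /eqP.
rewrite eq_Tagged/= => /eqP yy'; apply: val_inj => /=; congr existT.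
have Bk : B 0%N (val k) by apply: set_mem; exact: valP.
apply: (@parent_inj _ _ _ y') => //; last by rewrite yy'.
  exact: descendants_sub kx.
exact: descendants_sub kx'.
Qed.

(** By induction on the level, every node is joined to the root. *)
Lemma tree_edge_connected u v : exists p : seq V,
  path (fun x y => tree_edge x y || tree_edge y x) u p /\ last u p = v.
Proof.
pose e x y := tree_edge x y || tree_edge y x.
have e_sym : symmetric e by move=> x y; rewrite /e orbC.
suff root_joined w : joined e root_node w.
  by apply: (joined_trans _ (root_joined v)); exact: joined_sym.
have [n] := ubnP (tag (val w)); elim: n w => // n IH w wn.
have [->|[u' u'w]] := nodeP w; first by exists [::].
apply: (@joined_trans _ _ _ u').
  by apply: IH; move: wn; rewrite (edge_level u'w) ltnS.
by exists [:: w]; rewrite /= /e u'w.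
Qed.

Definition descent_tree : rooted_tree :=
  RootedTree edge_no_circuit tree_edge_connected root_no_edge edge_unique_parent.

Lemma par_arc (v : descent_tree) : v != tree_root descent_tree ->
  arc (val (par v : tree_nodes (val k))) (val (v : tree_nodes (val k))).
Proof.
move=> vr; apply/asboolP.
have [u [uv _]] := unique_parent vr.
exact: (@xgetPex _ (tree_root descent_tree) [set u | edge u v] (ex_intro _ u uv)).
Qed.

End tree_of_root.
End forest.
Arguments descendants {E} W k n.
Arguments tree_nodes {E} W k.

(** * The shift in tree coordinates *)

Section shift_on_trees.
Variables (R : realType) (H : nat -> hilbertType R).
Variables (B : forall n, set (H n)) (W : forall n, H n -> set (H n.+1)).
Arguments B : clear implicits.
Arguments W : clear implicits.
Hypothesis onbB : forall n, orthonormal_basis (B n).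
Hypothesis disjW : forall n, trivIset (B n) (W n).
Hypothesis unionW : forall n, B n.+1 = \bigcup_(x in B n) W n x.
Local Notation C := R[i].

(* The trees only use the sets underlying the Hilbert spaces. *)
Let E (n : nat) : choiceType := H n.

Definition basis_tree (k : B 0%N) : rooted_tree :=
  @descent_tree E B W disjW unionW k.

Definition node_of (k : B 0%N) (v : basis_tree k) : node E :=
  val (v : tree_nodes (E := E) W (val k)).

Lemma node_of_inj k : injective (@node_of k).
Proof. by move=> u v /val_inj. Qed.

Lemma node_ofP k (v : basis_tree k) :
  descendants (E := E) W (val k) (tag (node_of v)) (tagged (node_of v)).
Proof. exact: (set_mem (valP (v : tree_nodes (E := E) W (val k)))). Qed.

Let K : hilbertType R := hsum (fun k : B 0%N => ell2 R (basis_tree k)).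

Let esum_trees (F : node E -> \bar R) : (forall v, 0 <= F v)%E ->
  (\esum_(n in [set: nat]) \esum_(y in B n) F (existT _ n y) =
   \esum_(k in [set: B 0%N]) \esum_(v in [set: basis_tree k]) F (node_of v))%E.
Proof. exact: (esum_levels_trees disjW unionW). Qed.

Definition coef (x : hsum H) (v : node E) : scalarH R :=
  '[x (tag v), (tagged v : H (tag v))].

Lemma esum_coef x :
  (\esum_(k in [set: B 0%N]) \esum_(v in [set: basis_tree k])
     (sqnorm (coef x (node_of v)))%:E = (sqnorm x)%:E)%E.
Proof.
rewrite -(@esum_trees (fun v => (sqnorm (coef x v))%:E)).
  by rewrite [RHS]hsum_sqnormE; apply: eq_esum => n _; rewrite -(Parseval (onbB n)).
by move=> v; rewrite lee_fin sqnorm_ge0.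
Qed.

(** Taking coefficients is isometric because Parseval, applied level by level, and
    the sum over the trees add up the same numbers. It is onto because the
    coordinates of a vector y prescribe coefficients on every B n, which are
    realized level by level by Riesz-Fischer. *)
Lemma tree_unitary : exists2 U : {linear hsum H -> K}, unitary U &
  forall x k (v : basis_tree k), U x k v = coef x (node_of v).
Proof.
have /choice[U UE] (x : hsum H) :
    exists y : K, forall k (v : basis_tree k), y k v = coef x (node_of v).
  apply: (@hsum_nested_exists R (B 0%N) basis_tree (fun _ _ => scalarH R)).
  by rewrite esum_coef ltry.
have lin : linear U.
  move=> a x y; apply: hsum_ext => k; apply: hsum_ext => v.
  by rewrite !(hsumDE, hsumZE) !UE /coef hsumDE hsumZE (linearPl inner).
have [U' U'E] := linear_bundle lin.
exists U'; last by move=> x k v; rewrite U'E UE.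
have isoU x : `|U' x| = `|x|.
  apply: sqnorm_inj; apply: EFin_inj; rewrite -[RHS]esum_coef U'E.
  rewrite (@hsum_nested_sqnormE R (B 0%N) basis_tree (fun _ _ => scalarH R)).
  by apply: eq_esum => k _; apply: eq_esum => v _; rewrite UE.
split; first exact: isometry_inner.
move=> y.
(* c glues the families y k into one function on the nodes: a node lies in one tree. *)
have /choice[c cE] (w : node E) : exists z : scalarH R,
    forall k (v : basis_tree k), node_of v = w -> y k v = z.
  have [[k [v vw]]|h] := pselect (exists k (v : basis_tree k), node_of v = w).
    exists (y k v) => k' v' v'w.
    have kk' : k' = k.
      apply: val_inj; have := node_ofP v; have := node_ofP v'; rewrite vw v'w.
      by apply: (descendants_inj (E := E) disjW unionW); apply: set_mem; exact: valP.
    by case: _ / kk' v vw => v vw; congr (y _ _); apply: node_of_inj; rewrite vw.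
  by exists 0 => k v vw; case: h; exists k, v.
have c_norm : (\esum_(n in [set: nat]) \esum_(b in B n) (sqnorm (c (existT _ n b)))%:E =
    (sqnorm y)%:E)%E.
  rewrite (@esum_trees (fun w => (sqnorm (c w))%:E)); last first.
    by move=> v; rewrite lee_fin sqnorm_ge0.
  rewrite (@hsum_nested_sqnormE R (B 0%N) basis_tree (fun _ _ => scalarH R)).
  by apply: eq_esum => k _; apply: eq_esum => v _; rewrite (cE (node_of v) k v).
pose g n := (\esum_(b in B n) (sqnorm (c (existT _ n b)))%:E)%E.
have g0 n : (0 <= g n)%E.
  by apply: esum_ge0 => b _; rewrite lee_fin sqnorm_ge0.
have gsum : (\esum_(n in [set: nat]) g n < +oo)%E by rewrite c_norm ltry.
have /dep_choice[x xE] n : exists x : H n, forall b, B n b -> '[x, b] = c (existT _ n b).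
  exact: Riesz_Fischer (onbB n) _ (esum_term_lty g0 gsum n).
have xS : square_summable x.
  rewrite /square_summable.
  under eq_esum => n _ do rewrite -/(sqnorm _) -(Parseval (onbB n)).
  rewrite (eq_esum (b := g)) ?c_norm ?ltry// => n _.
  by apply: eq_esum => b Bb; rewrite xE.
exists (HSum xS); apply: hsum_ext => k; apply: hsum_ext => v.
rewrite U'E UE /coef /= xE; first by apply/esym/cE; case: (node_of v).
have := node_ofP v; apply: (descendants_sub unionW); exact: set_mem (valP k).
Qed.

Variables (A : forall n, {linear H n -> H n.+1}) (M : R).
Arguments A : clear implicits.
Hypothesis M_ge0 : 0 <= M.
Hypothesis A_le : forall n x, `|A n x| <= M%:C * `|x|.
Hypothesis subW : forall n x, B n x -> W n x `<=` B n.+1.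
Hypothesis sumW : forall n x, B n x ->
  has_sum (W n x) (fun y => '[A n x, y] *: y) (A n x).

(** This is the adjoint relation: the adjoint of A n sends y to a multiple of its
    parent p. Both sides are bounded functionals of x, so it suffices to compare
    them on B n; for b <> p the vector A n b is a sum over W n b, which does not
    contain y. *)
Lemma inner_child n (p : H n) (y : H n.+1) : B n p -> W n p y ->
  forall x, '[A n x, y] = '[x, p] * '[A n p, y].
Proof.
move=> Bp py x.
have By : B n.+1 y by exact: subW py.
have [onBn _] := onbB n; have [onBn1 _] := onbB n.+1.
have lin : linear (fun x => '[A n x, y] - '[x, p] * '[A n p, y] : scalarH R).
  move=> a u v; rewrite !linearP /= !(linearPl inner).
  by rewrite /GRing.scale /=; ring.
have [f fE] := linear_bundle lin.
have norm_re (V : normedModType C) (z : V) : (complex.Re `|z|)%:C = `|z|.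
  by rewrite RRe_real ?normr_real.
have re_ge0 (V : normedModType C) (z : V) : 0 <= complex.Re `|z|.
  by rewrite -lecR norm_re; exact: normr_ge0.
pose L := M * complex.Re `|y| + complex.Re `|p| * complex.Re `|('[A n p, y] : scalarH R)|.
have L0 : 0 <= L by rewrite addr_ge0 ?mulr_ge0 ?re_ge0.
suff fx0 : f x = 0 by apply/eqP; rewrite -subr_eq0 -fE fx0.
apply: (functional_onb_eq0 (onbB n) L0) => [z|b Bb].
  rewrite fE rmorphD !rmorphM /= !norm_re (le_trans (ler_normB _ _))// mulrDl.
  apply: lerD; last by rewrite normrM mulrAC ler_wpM2r// mulrC cauchy_schwarz.
  by rewrite (le_trans (cauchy_schwarz _ _))// mulrAC ler_wpM2r.
rewrite fE; have [->|bp] := eqVneq b p; first by rewrite onBn// eqxx mul1r subrr.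
rewrite [X in _ - X * _]onBn// (negPf bp) mul0r subr0.
apply: has_sum_orthogonal (sumW Bb) _ => w bw.
have wy : w != y.
  apply: contraNneq bp => wy; apply/eqP; apply: (disjW Bb Bp).
  by exists y; split => //; rewrite -wy.
have Bw : B n.+1 w := subW Bb bw.
by rewrite innerZl [X in _ * X]onBn1// (negPf wy) mulr0.
Qed.

(** The entry of the matrix of the shift between u = par v and v: the image of u is
    placed in the direct sum one level above u, and paired with v. Since only the
    family so obtained is read at the level of v, no transport along the equation
    between the levels of u and v is needed. *)
Definition tree_weight (k : B 0%N) (v : basis_tree k) : C :=
  let u := node_of (par v) in
  '[dfwith (fun n => 0 : H n) (tag u).+1 (A (tag u) (tagged u)) (tag (node_of v)),
    (tagged (node_of v) : H (tag (node_of v)))].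

Lemma coef_shift (T : {linear hsum H -> hsum H}) (x : hsum H) k (v : basis_tree k) :
  is_opshift A T -> v != tree_root (basis_tree k) ->
  coef (T x) (node_of v) = tree_weight v * coef x (node_of (par v)).
Proof.
move=> TA vr; rewrite /tree_weight.
have := par_arc vr; rewrite -/(node_of v) -/(node_of (par v)) => -[y uy ->] /=.
rewrite /coef /= (TA x).2 dfwithin mulrC; apply: inner_child uy _.
have := node_ofP (par v); apply: (descendants_sub unionW); exact: set_mem (valP k).
Qed.

Lemma coef_shift_root (T : {linear hsum H -> hsum H}) (x : hsum H) k :
  is_opshift A T -> coef (T x) (node_of (tree_root (basis_tree k))) = 0.
Proof. by move=> TA; rewrite /coef /= (TA x).1 (linear0l inner). Qed.

(** D is the transport of T by the unitary U of tree_unitary. Its formula in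
    coordinates is that of the tree shifts, which shows that it respects the
    summands, so that S k can be defined as its restriction to the k-th one; in
    particular the boundedness of S k follows from that of T. *)
Lemma shift_unitarily_tree_shifts (T : {linear hsum H -> hsum H}) : is_opshift A T ->
  exists (S : forall k, {linear ell2 R (basis_tree k) -> ell2 R (basis_tree k)})
    (D : {linear K -> K}),
    [/\ forall k, bounded_operator (S k),
        forall k, is_tree_shift (@tree_weight k) (S k),
        is_direct_sum S D
      & unitarily_equivalent T D].
Proof.
move=> TA; have [U [Uiso /choice[U' U'K]] UE] := tree_unitary.
have U_inj : injective U.
  move=> x y Uxy; apply/eqP; rewrite -subr_eq0 -normr_eq0 -sqrf_eq0 -inner_normE.
  by rewrite -Uiso linearB Uxy subrr (linear0l inner).
have UK x : U' (U x) = x by apply: U_inj; rewrite U'K.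
have normU' y : `|U' y| = `|y|.
  by apply/eqP; rewrite -(@eqrXn2 _ 2)// -!inner_normE -Uiso U'K.
have U'P a u v : U' (a *: u + v) = a *: U' u + U' v.
  by apply: U_inj; rewrite linearP !U'K.
have Dlin : linear (fun y => U (T (U' y))).
  by move=> a u v; rewrite U'P !linearP.
have [D DE] := linear_bundle Dlin.
have D_root y k : D y k (tree_root (basis_tree k)) = 0.
  by rewrite DE UE coef_shift_root.
have D_node y k (v : basis_tree k) : v != tree_root (basis_tree k) ->
    D y k v = tree_weight v * y k (par v).
  by move=> vr; rewrite DE UE coef_shift// -UE U'K.
pose j k := projT1 (cid2 (hsum_inj (fun k => ell2 R (basis_tree k)) k)).
have j_norm k f : `|j k f| = `|f| by rewrite /j; case: cid2.
have jE k f : j k f k = f by rewrite /j; case: cid2.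
have Slin k : linear (fun f => D (j k f) k).
  by move=> a u v; rewrite !linearP.
have /dep_choice[S SE] k := linear_bundle (Slin k).
exists S, D; split.
- move=> k; apply: (bounded_operatorP M_ge0) => f.
  rewrite SE (le_trans (hsum_coord_le _ k))// DE.
  have -> : `|U (T (U' (j k f)))| = `|T (U' (j k f))|.
    by rewrite -normU' UK.
  by rewrite (le_trans (opshift_le TA M_ge0 A_le _))// normU' j_norm.
- by move=> k f; rewrite SE; split=> [|v vr]; rewrite ?D_root ?D_node// jE.
- move=> y k; rewrite SE; apply: hsum_ext => v.
  have [->|vr] := eqVneq v (tree_root (basis_tree k)); first by rewrite !D_root.
  by rewrite !D_node// jE.
- exists U; last by move=> x; rewrite DE UK.
  by split=> // y; exists (U' y).
Qed.

End shift_on_trees.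

Theorem proposition2p7 (R : realType) (H : nat -> hilbertType R)
    (sepH : forall n, separable_space (H n))
    (A : forall n, {linear H n -> H n.+1})
    (supA : (ereal_sup [set opnorm (A n) | n in [set: nat]] < +oo)%E)
    (T : {linear hsum H -> hsum H}) (TA : is_opshift A T)
    (dimH0 : hdim_ge1 (H 0%N))
    (B : forall n, set (H n)) (onbB : forall n, orthonormal_basis (B n))
    (W : forall n, H n -> set (H n.+1))
    (subW : forall n x, B n x -> W n x `<=` B n.+1)
    (disjW : forall n, trivIset (B n) (W n))
    (unionW : forall n, B n.+1 = \bigcup_(x in B n) W n x)
    (neqW : forall n x, B n x -> forall y, W n x y -> '[A n x, y] != 0)
    (sumW : forall n x, B n x ->
      has_sum (W n x) (fun y => '[A n x, y] *: y) (A n x)) :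
  exists2 I : choiceType, has_hdim (H 0%N) I &
    exists (V : I -> rooted_tree) (lam : forall k, V k -> R[i])
      (S : forall k, {linear ell2 R (V k) -> ell2 R (V k)})
      (D : {linear hsum (fun k => ell2 R (V k)) ->
                   hsum (fun k => ell2 R (V k))}),
      [/\ forall k, bounded_operator (S k),
          forall k, is_tree_shift (lam k) (S k),
          is_direct_sum S D
        & unitarily_equivalent T D].
Proof.
have [M M0 AM] := opnorm_sup supA.
exists (B 0%N : choiceType); first by exists (B 0%N); [exact: onbB|exact: card_setT_sym].
exists (basis_tree disjW unionW), (fun k => @tree_weight R H B W disjW unionW A k).
exact: (@shift_unitarily_tree_shifts R H B W onbB disjW unionW A M M0 AM subW sumW T TA).
Qed.
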